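(* Let $R$ be an irreducible-finite domain (IFD). Then $\mathrm{Int}(\{s\},R)$ is an idf-domain for every $s \in R$.
   Context: For an integral domain $R$ with quotient field $K$ and a subset $S$ of $R$, $\mathrm{Int}(S,R) := \{p(x) \in K[x] \mid p(S) \subseteq R\}$ is the ring of integer-valued polynomials of $R$ on $S$, a subring of $K[x]$. An integral domain is an irreducible-finite domain (IFD) if it contains only finitely many irreducibles up to associates (possibly none); atomicity is not required. An integral domain is an idf-domain (irreducible-divisor-finite domain) if every nonzero element has only finitely many irreducible divisors up to associates. *)

(* Defs.v *)
From HB Require Import structures.
From mathcomp Require Import all_boot all_order all_algebra.
From mathcomp Require Import boolp classical_sets functions cardinality.

Set Implicit Arguments.
Unset Strict Implicit.
Unset Printing Implicit Defensive.

Import GRing.Theory.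

Local Open Scope classical_set_scope.
Local Open Scope ring_scope.

Section Factorization.
Variable D : idomainType.
Implicit Types (a b : D) (A : set D).

Definition divides a b := exists c, b = a * c.

Definition associated a b := exists2 u, u \is a GRing.unit & b = u * a.

Definition irreducible_elt a :=
  [/\ a != 0, a \isn't a GRing.unit &
      forall b c, a = b * c -> b \is a GRing.unit \/ c \is a GRing.unit].

(* The elements of a set being finite in number up to associates is
   rendered as finiteness of the set of their associate classes. *)
Definition associate_class a : set D := [set b | associated a b].

Definition finite_upto_associates A := finite_set (associate_class @` A).

Definition irreducible_finite_domain :=
  finite_upto_associates [set a | irreducible_elt a].

Definition idf_domain :=
  forall b, b != 0 ->
    finite_upto_associates [set a | irreducible_elt a /\ divides a b].

End Factorization.

Section IntegerValuedPolynomials.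
Variables (R : idomainType) (S : set R).

(* [FracField.tofrac] is the embedding of R into its quotient field. *)
Definition int_valued : {pred {poly {fraction R}}} :=
  fun p => `[< forall s, S s ->
                 exists r : R, p.[FracField.tofrac s] = FracField.tofrac r >].

Lemma int_valuedP (p : {poly {fraction R}}) :
  reflect (forall s, S s ->
             exists r : R, p.[FracField.tofrac s] = FracField.tofrac r)
          (p \in int_valued).
Proof. exact: asboolP. Qed.

Lemma int_valued_subring_closed : subring_closed int_valued.
Proof.
split=> [|p q /int_valuedP pP /int_valuedP qP|p q /int_valuedP pP /int_valuedP qP].
- by apply/int_valuedP => s _; exists 1; rewrite hornerC rmorph1.
- apply/int_valuedP => s Ss; have [a pa] := pP s Ss; have [b qb] := qP s Ss.
  by exists (a - b); rewrite hornerD hornerN pa qb rmorphB.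
- apply/int_valuedP => s Ss; have [a pa] := pP s Ss; have [b qb] := qP s Ss.
  by exists (a * b); rewrite hornerM pa qb rmorphM.
Qed.

HB.instance Definition _ :=
  GRing.isSubringClosed.Build {poly {fraction R}} int_valued
    int_valued_subring_closed.

Record int_poly := IntPoly {
  int_poly_val :> {poly {fraction R}};
  int_poly_valP : int_poly_val \in int_valued }.

HB.instance Definition _ := [isSub for int_poly_val].
HB.instance Definition _ := [Choice of int_poly by <:].
HB.instance Definition _ := [SubChoice_isSubComNzRing of int_poly by <:].

(* Int(S,R) is not closed under inversion in {poly {fraction R}}, so its unit
   structure is not inherited: units are the elements invertible in Int(S,R)
   itself, and non-units are their own inverse by library convention. *)
Definition int_poly_unit : {pred int_poly} :=
  fun p => `[< exists q : int_poly, q * p = 1 >].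

Definition int_poly_inv (p : int_poly) : int_poly :=
  xget p [set q | q * p = 1].

Lemma int_poly_mulVr : {in int_poly_unit, left_inverse 1 int_poly_inv *%R}.
Proof.
by move=> p /asboolP [q qp1]; rewrite /int_poly_inv; case: xgetP => // /(_ q) [].
Qed.

Lemma int_poly_unitPl (p q : int_poly) : q * p = 1 -> int_poly_unit p.
Proof. by move=> qp1; apply/asboolP; exists q. Qed.

Lemma int_poly_inv_out : {in [predC int_poly_unit], int_poly_inv =1 id}.
Proof.
move=> p /= /asboolP pN; rewrite /int_poly_inv; case: xgetP => // q _ /= qp1.
by case: pN; exists q.
Qed.

HB.instance Definition _ := GRing.ComNzRing_hasMulInverse.Build int_poly
  int_poly_mulVr int_poly_unitPl int_poly_inv_out.

Lemma int_poly_mulf_eq0 (p q : int_poly) : p * q = 0 -> (p == 0) || (q == 0).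
Proof.
move=> /(congr1 val); rewrite rmorphM rmorph0 => /eqP.
by rewrite mulf_eq0 -!(rmorph0 (val : int_poly -> _)) !(inj_eq val_inj).
Qed.

HB.instance Definition _ :=
  GRing.ComUnitRing_isIntegral.Build int_poly int_poly_mulf_eq0.

End IntegerValuedPolynomials.

(* Main.v *)
Require Import Defs.
From mathcomp Require Import all_boot all_algebra.
From mathcomp Require Import boolp classical_sets cardinality.

(** Evaluation at [s] maps [D = Int({s}, R)] onto [R], and a polynomial over the
   quotient field [K] belongs to [D] as soon as its value at [s] lies in [R].
   Rescaling by elements of [K] is therefore easy in [D], and this is what makes
   the irreducible elements of [D] rigid.

   Fix a nonzero [f] in [D].  The constant irreducible divisors of [f] are
   irreducible elements of [R], so that the hypothesis on [R] bounds their
   number.  The nonconstant ones divide [f] in [K[x]], where [f] has finitely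
   many divisors up to a scalar of [K] ([finite_divisors_poly]).  What remains
   is that two nonconstant irreducible elements [a] and [b = k *: a] of [D] are
   already associated in [D] ([eqp_irreducible_associated]).

   If [r := a(s)] is nonzero, then [a = r * (r^-1 *: a)] is a factorization in
   [D], because the second factor takes the value 1 at [s]; as that factor is
   not constant, [r] is a unit.  Likewise [b(s)] is a unit, and so is the ratio
   [k = b(s) / a(s)].  If [a(s) = 0], then [d^-1 *: a] is in [D] for every
   nonzero [d] in [R], and it is not a unit, so that every nonzero [d] in [R] is
   a unit; writing [k] as a fraction then shows that [k] is a unit of [R].  (So
   such an [a] exists only if [R] is a field.) *)

Set Implicit Arguments.
Unset Strict Implicit.
Unset Printing Implicit Defensive.

Import GRing.Theory.

Local Open Scope classical_set_scope.
Local Open Scope ring_scope.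

Local Notation "x %:F" := (@FracField.tofrac _ x) : ring_scope.

(** * Finiteness up to associates *)

Section Associates.
Variable D : idomainType.
Implicit Types (a b c : D) (A B : set D).

Lemma associated_refl a : associated a a.
Proof. by exists 1; rewrite ?unitr1 ?mul1r. Qed.

Lemma associated_sym a b : associated a b -> associated b a.
Proof. by case=> u uu ->; exists u^-1; rewrite ?unitrV ?mulKr. Qed.

Lemma associated_trans b a c :
  associated a b -> associated b c -> associated a c.
Proof.
by case=> u uu -> [v vu ->]; exists (v * u); rewrite ?unitrM ?vu ?mulrA.
Qed.

Lemma associate_class_eqP a b :
  associate_class a = associate_class b <-> associated a b.
Proof.
split=> ab.
  by have : associate_class b b := associated_refl b; rewrite -ab.
apply/seteqP; split=> c /=; apply: associated_trans => //.
exact: associated_sym.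
Qed.

(** A finite set of labels suffices, even if the labelling is only a relation:
   each label determines at most one class. *)
Lemma finite_upto_associates_label (T : choiceType) (F : set T)
    (labels : T -> D -> Prop) A :
    finite_set F ->
    (forall a, A a -> exists2 t, F t & labels t a) ->
    (forall t a b, A a -> A b -> labels t a -> labels t b -> associated a b) ->
  finite_upto_associates A.
Proof.
move=> finF exF labA.
pose h t := xget set0 (@associate_class D @` [set a | A a /\ labels t a]).
apply: (@sub_finite_set _ _ (h @` F)); last exact: finite_image.
move=> _ [a Aa <-]; have [t Ft ta] := exF a Aa; exists t => //.
rewrite /h; case: xgetP => [_ _ [b [Ab tb] <-]|/(_ (associate_class a))[]].
  by apply/associate_class_eqP; apply: labA tb ta.
by exists a.
Qed.

Lemma finite_upto_associatesU A B :
  finite_upto_associates A -> finite_upto_associates B ->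
  finite_upto_associates (A `|` B).
Proof. by move=> fA fB; rewrite /finite_upto_associates image_setU finite_setU. Qed.

Lemma sub_finite_upto_associates A B :
  A `<=` B -> finite_upto_associates B -> finite_upto_associates A.
Proof. by move=> AB; apply/sub_finite_set/image_subset. Qed.

End Associates.

(** * Divisors of a polynomial over a field *)

Section PolynomialDivisors.
Variable K : fieldType.
Implicit Types d f g h : {poly K}.

(** The factors are [gcdp d g] and its cofactor in [d], which is coprime to
   [g %/ gcdp d g] and so divides [h]. *)
Lemma dvdp_mul_split d g h : g != 0 -> d %| g * h ->
  exists d1 d2, [/\ d = d1 * d2, d1 %| g & d2 %| h].
Proof.
move=> g0 dgh; have gcd0 : gcdp d g != 0 by rewrite gcdp_eq0 negb_and g0 orbT.
exists (gcdp d g), (d %/ gcdp d g); rewrite dvdp_gcdr divpKC ?dvdp_gcdl //.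
split=> //; rewrite -(@Gauss_dvdpr _ _ (g %/ gcdp d g)).
  by rewrite -(dvdp_mul2l _ _ gcd0) mulrA !divpKC ?dvdp_gcdl ?dvdp_gcdr.
by rewrite coprimep_div_gcd // g0 orbT.
Qed.

(** Induction on the size: if [f = g * h] with both factors smaller than [f],
   then each divisor of [f] is a product of a divisor of [g] and one of [h];
   without such a factorization, the divisors are those of the list [:: 1; f]. *)
Lemma finite_divisors_poly f : f != 0 ->
  exists ds : seq {poly K}, forall d, d %| f -> exists2 e, e \in ds & d %= e.
Proof.
have [n] := ubnP (size f); elim: n => // n IHn in f * => /ltnSE lefn f0.
have [[g [gf g1 gltf]]|irr] :=
  pselect (exists g, [/\ g %| f, (1 < size g)%N & (size g < size f)%N]); last first.
  exists [:: 1; f] => d df; have := dvdp_leq f0 df.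
  rewrite leq_eqVlt (dvdp_size_eqp df) => /orP[deqf|dltf].
    by exists f; rewrite // !inE eqxx orbT.
  exists 1; rewrite ?inE ?eqxx // -size_poly_eq1 eqn_leq size_poly_gt0.
  rewrite (dvdpN0 df f0) andbT leqNgt; apply/negP => d1.
  by apply: irr; exists d.
have g0 : g != 0 by apply: dvdpN0 gf f0.
have [h fE] : exists h, f = g * h by exists (f %/ g); rewrite divpKC.
have h0 : h != 0 by apply: contraNneq f0; rewrite fE => ->; rewrite mulr0.
have [||gs gsP] := IHn g => //; first exact: leq_trans gltf lefn.
have [||hs hsP] := IHn h => //.
  by apply: leq_trans lefn; rewrite fE size_mul // -subn1 ltn_subRL ltn_add2r.
exists [seq x * y | x <- gs, y <- hs] => d.
rewrite fE => /(dvdp_mul_split g0)[d1 [d2 [-> /gsP[e1 e1gs de1] /hsP[e2 e2hs de2]]]].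
exists (e1 * e2); first exact: allpairs_f.
exact: eqp_trans (eqp_mulr _ de1) (eqp_mull _ de2).
Qed.

End PolynomialDivisors.

(** * Irreducible elements of Int({s}, R) *)

Lemma fraction_numden (R : idomainType) (x : {fraction R}) :
  exists n d : R, d != 0 /\ x = n%:F / d%:F.
Proof.
elim/quotW: x => x; exists \n_x, \d_x; split; first exact: denom_ratioP.
apply: (canRL (mulfK _)); first by rewrite tofrac_eq0 denom_ratioP.
rewrite !piE; apply/eqmodP => /=.
rewrite FracField.equivfE /FracField.mulf.
rewrite !numden_Ratio ?mulf_neq0 ?oner_eq0 ?denom_ratioP //.
by rewrite !mulr1 mulrC.
Qed.

Section IntPolyPoint.
Variables (R : idomainType) (s : R).

Local Notation K := {fraction R}.
Local Notation D := (int_poly [set s]).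
Implicit Types (a b u : D) (r d w : R) (p : {poly K}).

Lemma int_poly_of_value p r : p.[s%:F] = r%:F -> exists a, val a = p.
Proof.
move=> pr; have pI : p \in int_valued [set s].
  by apply/int_valuedP => _ ->; exists r.
by exists (IntPoly pI).
Qed.

Fact int_const_subproof r : r%:F%:P \in int_valued [set s].
Proof. by apply/int_valuedP => t _; exists r; rewrite hornerC. Qed.
Definition int_const r : D := IntPoly (int_const_subproof r).

Definition int_value a : R := xget 0 [set r | (val a).[s%:F] = r%:F].

Lemma int_valueE a : (val a).[s%:F] = (int_value a)%:F.
Proof.
rewrite /int_value; case: xgetP => // noval.
by have /int_valuedP/(_ s erefl)[r /noval] := valP a.
Qed.

Lemma eq_int_value a r : (val a).[s%:F] = r%:F -> int_value a = r.
Proof. by rewrite int_valueE => /eqP; rewrite tofrac_eq => /eqP. Qed.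

Lemma int_value_const r : int_value (int_const r) = r.
Proof. by apply: eq_int_value; rewrite hornerC. Qed.

Lemma int_constM : {morph int_const : r d / r * d}.
Proof. by move=> r d; apply: val_inj; rewrite rmorphM /= rmorphM polyCM. Qed.

Lemma val_int_constM r a : val (int_const r * a) = r%:F *: val a.
Proof. by rewrite rmorphM mul_polyC. Qed.

Lemma unit_int_value u : u \is a GRing.unit -> int_value u \is a GRing.unit.
Proof.
case/unitrP=> v [vu _]; apply/unitrPr; exists (int_value v).
apply/eqP; rewrite -tofrac_eq tofracM -!int_valueE -hornerM mulrC.
by rewrite -rmorphM vu rmorph1 hornerC tofrac1.
Qed.

Lemma unit_int_const r : (int_const r \is a GRing.unit) = (r \is a GRing.unit).
Proof.
apply/idP/idP => [/unit_int_value|ru]; first by rewrite int_value_const.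
apply/unitrPr; exists (int_const r^-1); rewrite -int_constM divrr //.
by apply: val_inj; rewrite /= !rmorph1.
Qed.

Lemma size_unit_int_poly u : u \is a GRing.unit -> size (val u) = 1%N.
Proof.
by move=> /(rmorph_unit val); rewrite poly_unitE => /andP[/eqP].
Qed.

Lemma int_poly_const a : (size (val a) <= 1)%N -> a = int_const (int_value a).
Proof.
move=> /size1_polyC aE; apply: val_inj => /=.
by rewrite -int_valueE aE hornerC.
Qed.

Lemma irreducible_int_const r :
  irreducible_elt (int_const r) -> irreducible_elt r.
Proof.
case=> r0 rU rI; split; last first.
- move=> b c rE; have := congr1 int_const rE.
  by rewrite int_constM => /rI; rewrite !unit_int_const.
- by rewrite -unit_int_const.
- by apply: contraNneq r0 => ->; apply/eqP/val_inj; rewrite /= !rmorph0.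
Qed.

(** The source of all the rigidity: [a] is the product in [D] of the constant
   [d] and of [d^-1 *: a].  The next two lemmas exclude the second alternative,
   by comparing sizes or values at [s]. *)
Lemma irreducible_scale_unit a d r : irreducible_elt a -> d != 0 ->
    (d%:F^-1 *: val a).[s%:F] = r%:F ->
  d \is a GRing.unit \/
  exists2 b : D, b \is a GRing.unit & val b = d%:F^-1 *: val a.
Proof.
case=> _ _ aI d0 /int_poly_of_value[b bE].
have /aI : a = int_const d * b.
  apply: val_inj; rewrite val_int_constM bE scalerA mulfV ?scale1r //.
  by rewrite tofrac_eq0.
by rewrite unit_int_const => -[]; [left | right; exists b].
Qed.

Lemma irreducible_int_value_unit a : irreducible_elt a ->
  (1 < size (val a))%N -> int_value a != 0 -> int_value a \is a GRing.unit.
Proof.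
move=> aI a1 va0; have v0 : (int_value a)%:F != 0 by rewrite tofrac_eq0.
have [|//|[b bU bE]] := @irreducible_scale_unit a _ 1 aI va0.
  by rewrite hornerZ int_valueE mulVf ?rmorph1.
by move: a1; rewrite -(size_scale _ (invr_neq0 v0)) -bE size_unit_int_poly.
Qed.

Lemma irreducible_value0_unit a d :
  irreducible_elt a -> int_value a = 0 -> d != 0 -> d \is a GRing.unit.
Proof.
move=> aI va0 d0; have ad0 : (d%:F^-1 *: val a).[s%:F] = 0%:F.
  by rewrite hornerZ int_valueE va0 rmorph0 mulr0.
have [//|[b bU bE]] := irreducible_scale_unit aI d0 ad0.
have := unit_int_value bU.
by rewrite (@eq_int_value b 0) ?unitr0 // bE ad0.
Qed.

Lemma scale_unit_associated a b w : w \is a GRing.unit ->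
  val b = w%:F *: val a -> associated a b.
Proof.
move=> wU bE; exists (int_const w); rewrite ?unit_int_const //.
by apply: val_inj; rewrite val_int_constM.
Qed.

(** The scalar relating [a] and [b] is the ratio of their values at [s] if these
   are nonzero; otherwise [R] is a field and every nonzero scalar is a unit. *)
Lemma eqp_irreducible_associated a b :
    irreducible_elt a -> irreducible_elt b ->
    (1 < size (val a))%N -> val a %= val b ->
  associated a b.
Proof.
move=> aI bI a1 ab; have b1 : (1 < size (val b))%N by rewrite -(eqp_size ab).
have [k k0 bE] : exists2 k, k != 0 & val b = k *: val a.
  by apply/eqpf_eq; rewrite eqp_sym.
have vbE : (int_value b)%:F = k * (int_value a)%:F.
  by rewrite -!int_valueE bE hornerZ.
have [va0|va0] := eqVneq (int_value a) 0.
  have [n [d [d0 kE]]] := fraction_numden k.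
  have n0 : n != 0.
    by apply: contraNneq k0; rewrite kE => ->; rewrite rmorph0 mul0r.
  have dU := irreducible_value0_unit aI va0 d0.
  have nU := irreducible_value0_unit aI va0 n0.
  apply: (@scale_unit_associated _ _ (n / d)); first by rewrite unitrM unitrV nU.
  by rewrite bE kE rmorphM rmorphV.
have vb0 : int_value b != 0 by rewrite -tofrac_eq0 vbE mulf_neq0 // tofrac_eq0.
have vaU := irreducible_int_value_unit aI a1 va0.
have vbU := irreducible_int_value_unit bI b1 vb0.
apply: (@scale_unit_associated _ _ (int_value b / int_value a)).
  by rewrite unitrM unitrV vbU.
by rewrite bE rmorphM rmorphV //= vbE mulfK ?tofrac_eq0.
Qed.

Lemma finite_constant_irreducibles : irreducible_finite_domain R ->
  finite_upto_associates
    [set a : D | irreducible_elt a /\ (size (val a) <= 1)%N].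
Proof.
move=> finR; (* A constant is labelled by the class of its value in [R]. *)
pose lab C a := associate_class (int_value a) = C.
apply: (finite_upto_associates_label (labels := lab) finR) => [a|C a b].
  move=> [aI a1]; exists (associate_class (int_value a)) => //.
  exists (int_value a) => //; apply: irreducible_int_const.
  by rewrite -int_poly_const.
move=> [_ a1] [_ b1] <- /esym/associate_class_eqP[u uU vbE].
rewrite (int_poly_const a1) (int_poly_const b1) vbE int_constM.
by exists (int_const u); rewrite ?unit_int_const.
Qed.

Lemma finite_nonconstant_irreducible_divisors f : f != 0 ->
  finite_upto_associates
    [set a : D | [/\ irreducible_elt a, divides a f & (1 < size (val a))%N]].
Proof.
move=> f0; have vf0 : val f != 0 by rewrite -[0](rmorph0 (val : int_poly [set s] -> _)) (inj_eq val_inj).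
have [ds dsP] := finite_divisors_poly vf0.
(* A divisor is labelled by the listed polynomial proportional to it. *)
pose lab (e : {poly K}) a := val a %= e.
apply: (finite_upto_associates_label (labels := lab) (finite_seq ds)).
  move=> a [_ [c fE] _]; have [|e eds ae] := dsP (val a); last by exists e.
  by rewrite fE rmorphM dvdp_mulIl.
move=> e a b [aI _ a1] [bI _ _] ae be.
apply: eqp_irreducible_associated => //.
by apply: eqp_trans ae _; rewrite eqp_sym.
Qed.

End IntPolyPoint.

Theorem theorem5p8 (R : idomainType) :
  irreducible_finite_domain R ->
  forall s : R, idf_domain (int_poly [set s]%classic).
Proof.
move=> finR s f f0.
have finD := finite_upto_associatesU (finite_constant_irreducibles s finR)
  (finite_nonconstant_irreducible_divisors f0).
apply: sub_finite_upto_associates finD => a [aI af].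
by have [a1|a1] := leqP (size (val a)) 1; [left | right].
Qed.
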